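(* Let $F$ be a field, let $1\le r<n$, and let $\varphi=(\varphi_1,\dots,\varphi_n)$ with $\varphi_i\in F[[x_1,\dots,x_n]]$ having zero constant term. Suppose that the matrix of linear terms of $\varphi$ is in Jordan canonical form, with $\lambda_i$ the multiplier in the $x_i$-direction. Suppose that none of $\lambda_1,\dots,\lambda_r$ lies in the multiplicative semigroup generated by $\lambda_{r+1},\dots,\lambda_n$. Then there exists a unique formal analytic subvariety $V$ (passing through the origin), defined by equations $x_i=f_i(x_{r+1},\dots,x_n)$ for $i=1,\dots,r$ with $f_i\in F[[x_{r+1},\dots,x_n]]$ having zero constant term, such that $V$ is fixed under the action of $\varphi$. Moreover, $V$ defines a formal conjugacy $x_i\mapsto x_i-f_i$ ($1\le i\le r$), $x_j\mapsto x_j$ ($r<j\le n$), to a formal map under which the linear subvariety $x_1=\dots=x_r=0$ is fixed; that is, if $(\tilde\varphi_1,\dots,\tilde\varphi_n)$ denotes the conjugated map, then setting $x_1=\dots=x_r=0$ gives $\tilde\varphi_1=\dots=\tilde\varphi_r=0$.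
   Context: The matrix of linear terms of $\varphi$ is the matrix whose $(i,j)$ entry is the coefficient of $x_j$ in $\varphi_i$; it being in Jordan canonical form means that the linear part of each $\varphi_i$ is $\lambda_i x_i$, or $\lambda_i x_i+x_{i+1}$ when $x_i$ is not the last variable of its Jordan block. The multiplicative semigroup generated by $\lambda_{r+1},\dots,\lambda_n$ is the set of products $\lambda_{r+1}^{\alpha_{r+1}}\cdots\lambda_n^{\alpha_n}$ with integers $\alpha_j\ge 0$ and at least one $\alpha_j>0$. The formal subvariety $V$ given by $x_i=f_i(x_{r+1},\dots,x_n)$, $1\le i\le r$, is fixed under $\varphi$ if, for each $i=1,\dots,r$, substituting $x_l=f_l(x_{r+1},\dots,x_n)$ for $l=1,\dots,r$ makes $\varphi_i=f_i(\varphi_{r+1},\dots,\varphi_n)$ an identity in $F[[x_{r+1},\dots,x_n]]$. The conjugated map has components, for $i\le r$, $\tilde\varphi_i=\varphi_i(x_1+f_1,\dots,x_r+f_r,x_{r+1},\dots,x_n)-f_i(\tilde\varphi_{r+1},\dots,\tilde\varphi_n)$, and for $j>r$, $\tilde\varphi_j=\varphi_j(x_1+f_1,\dots,x_r+f_r,x_{r+1},\dots,x_n)$. *)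

(* Defs.v *)
From HB Require Import structures.
From mathcomp Require Import all_boot all_order all_algebra.
From mathcomp Require Import boolp.
From mathcomp Require Import mpoly.

Set Implicit Arguments.
Unset Strict Implicit.
Unset Printing Implicit Defensive.

Import GRing.Theory.
Local Open Scope ring_scope.

Record fps (n : nat) (R : Type) := FPS { fcoef : 'X_{1..n} -> R }.

Lemma fpsP (n : nat) (R : Type) (f g : fps n R) :
  (forall m, fcoef f m = fcoef g m) -> f = g.
Proof. by case: f g => [f] [g] /= fg; congr FPS; apply: funext. Qed.

HB.instance Definition _ (n : nat) (R : Type) := gen_eqMixin (fps n R).
HB.instance Definition _ (n : nat) (R : Type) := gen_choiceMixin (fps n R).

Section Ring.
Variables (n : nat) (R : comNzRingType).
Implicit Types f g h : fps n R.

Definition fps_zero : fps n R := FPS (fun=> 0).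
Definition fps_one : fps n R := FPS (fun m => (m == 0%MM)%:R).
Definition fps_opp f : fps n R := FPS (fun m => - fcoef f m).
Definition fps_add f g : fps n R := FPS (fun m => fcoef f m + fcoef g m).
Definition fps_mul f g : fps n R :=
  FPS (fun m => \sum_(k : 'X_{1..n < (mdeg m).+1, (mdeg m).+1}
                      | m == (k.1 + k.2)%MM) fcoef f k.1 * fcoef g k.2).

Fact fps_addA : associative fps_add.
Proof. by move=> f g h; apply: fpsP => m /=; rewrite addrA. Qed.
Fact fps_addC : commutative fps_add.
Proof. by move=> f g; apply: fpsP => m /=; rewrite addrC. Qed.
Fact fps_add0 : left_id fps_zero fps_add.
Proof. by move=> f; apply: fpsP => m /=; rewrite add0r. Qed.
Fact fps_addN : left_inverse fps_zero fps_opp fps_add.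
Proof. by move=> f; apply: fpsP => m /=; rewrite addNr. Qed.

HB.instance Definition _ :=
  GRing.isZmodule.Build (fps n R) fps_addA fps_addC fps_add0 fps_addN.

(* The ring laws are transported from {mpoly R[n]} along truncation. *)
Definition fps_trunc (d : nat) f : {mpoly R[n]} :=
  \sum_(k : 'X_{1..n < d}) fcoef f k *: 'X_[k].

Lemma mcoeff_trunc d f m :
  (mdeg m < d)%N -> (fps_trunc d f)@_m = fcoef f m.
Proof. exact: mcoeff_mpoly. Qed.

Lemma mcoeffM_eq (p q p' q' : {mpoly R[n]}) m :
    (forall k, (mdeg k <= mdeg m)%N -> p@_k = p'@_k) ->
    (forall k, (mdeg k <= mdeg m)%N -> q@_k = q'@_k) ->
  (p * q)@_m = (p' * q')@_m.
Proof.
move=> pE qE; rewrite !mcoeffM; apply: eq_bigr => -[k1 k2] _ /=.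
by rewrite pE ?qE // -ltnS; [case: k2 | case: k1].
Qed.

Lemma fcoefM_trunc d f g m : (mdeg m < d)%N ->
  fcoef (fps_mul f g) m = (fps_trunc d f * fps_trunc d g)@_m.
Proof.
move=> md; rewrite mcoeffM /=; apply: eq_bigr => -[[k1 h1] [k2 h2]] _ /=.
by rewrite !mcoeff_trunc // (leq_trans _ md).
Qed.

Fact fps_mulA : associative fps_mul.
Proof.
move=> f g h; apply: fpsP => m; rewrite !(@fcoefM_trunc (mdeg m).+1) //.
rewrite (@mcoeffM_eq _ _ (fps_trunc (mdeg m).+1 f)
  (fps_trunc (mdeg m).+1 g * fps_trunc (mdeg m).+1 h)) //; last first.
  by move=> k km; rewrite mcoeff_trunc // (@fcoefM_trunc (mdeg m).+1).
rewrite mulrA; apply: mcoeffM_eq => // k km.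
by rewrite mcoeff_trunc // (@fcoefM_trunc (mdeg m).+1).
Qed.

Fact fps_mulC : commutative fps_mul.
Proof.
by move=> f g; apply: fpsP => m; rewrite !(@fcoefM_trunc (mdeg m).+1) // mulrC.
Qed.

Fact fps_mul1 : left_id fps_one fps_mul.
Proof.
move=> f; apply: fpsP => m; rewrite (@fcoefM_trunc (mdeg m).+1) //.
rewrite (@mcoeffM_eq _ _ 1 (fps_trunc (mdeg m).+1 f)) ?mul1r ?mcoeff_trunc //.
by move=> k km; rewrite mcoeff_trunc // mcoeff1.
Qed.

Fact fps_mulD : left_distributive fps_mul fps_add.
Proof.
move=> f g h; apply: fpsP => m /=; rewrite -big_split /=.
by apply: eq_bigr => k _; rewrite mulrDl.
Qed.

Fact fps_one_neq0 : fps_one != fps_zero.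
Proof.
apply/eqP => /(congr1 (fun f => fcoef f 0%MM)) /=; rewrite eqxx => /eqP.
by rewrite oner_eq0.
Qed.

HB.instance Definition _ := GRing.Zmodule_isComNzRing.Build (fps n R)
  fps_mulA fps_mulC fps_mul1 fps_mulD fps_one_neq0.

Definition fps_var (i : 'I_n) : fps n R :=
  FPS (fun m => (m == U_(i)%MM)%:R).

End Ring.

(* [fps_comp f g] is f(g_1, ..., g_n), meaningful when every g_i has zero
   constant term: then a monomial of f of degree > mdeg u contributes nothing
   to the coefficient of u, so the finite sum below is the whole sum. *)
Definition fps_comp (n m : nat) (R : comNzRingType)
    (f : fps n R) (g : 'I_n -> fps m R) : fps m R :=
  FPS (fun u => \sum_(k : 'X_{1..n < (mdeg u).+1})
                  fcoef f k * fcoef (\prod_(i < n) g i ^+ k i) u).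

Section FormalMaps.
Variable F : fieldType.

Definition no_const (n m : nat) (g : 'I_n -> fps m F) : Prop :=
  forall i, fcoef (g i) 0%MM = 0.

Definition map_comp (l m n : nat)
    (g : 'I_m -> fps l F) (h : 'I_l -> fps n F) : 'I_m -> fps n F :=
  fun i => fps_comp (g i) h.

Definition linear_mx (n : nat) (phi : 'I_n -> fps n F) : 'M[F]_n :=
  \matrix_(i, j) fcoef (phi i) U_(j)%MM.

Definition jordan_block (p : nat) (c : F) : 'M[F]_p :=
  \matrix_(i, j) (if j == i :> nat then c
                  else if j == i.+1 :> nat then 1 else 0).

Definition jordan_form (n : nat) (A : 'M[F]_n) : Prop :=
  exists (k : nat) (p : 'I_k -> nat) (c : 'I_k -> F)
         (pn : (\sum_(b < k) p b)%N = n),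
    (forall b, 0 < p b)%N /\
    A = castmx (pn, pn) (\mxdiag_(b < k) jordan_block (p b) (c b)).

Definition mul_semigroup (s : nat) (mu : 'I_s -> F) (x : F) : Prop :=
  exists a : 'I_s -> nat,
    (exists j, 0 < a j)%N /\ x = \prod_(j < s) mu j ^+ a j.

(* [r + s] variables: x_1..x_r are indexed by [lshift s i] with [i : 'I_r],
   and x_{r+1}..x_{r+s} by [rshift r j] with [j : 'I_s]. *)
Section Subvariety.
Variables r s : nat.
Implicit Types (f : 'I_r -> fps s F) (phi : 'I_(r + s) -> fps (r + s) F).

(* (x_{r+1}, ..., x_n) |-> (f_1, ..., f_r, x_{r+1}, ..., x_n) *)
Definition graph f : 'I_(r + s) -> fps s F :=
  fun k => match split k with inl i => f i | inr j => fps_var F j end.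

Definition fixed_under phi f : Prop :=
  forall i : 'I_r,
    fps_comp (phi (lshift s i)) (graph f) =
    fps_comp (f i) (fun j => fps_comp (phi (rshift r j)) (graph f)).

(* f_i regarded as a series in all the variables x_1, ..., x_n *)
Definition lift_tail f (i : 'I_r) : fps (r + s) F :=
  fps_comp (f i) (fun j => fps_var F (rshift r j)).

Definition straighten f : 'I_(r + s) -> fps (r + s) F :=
  fun k => match split k with
           | inl i => fps_var F k - lift_tail f i
           | inr _ => fps_var F k
           end.

Definition unstraighten f : 'I_(r + s) -> fps (r + s) F :=
  fun k => match split k with
           | inl i => fps_var F k + lift_tail f i
           | inr _ => fps_var F k
           end.

Definition conj_tail phi f (j : 'I_s) : fps (r + s) F :=
  fps_comp (phi (rshift r j)) (unstraighten f).

Definition conjugated phi f : 'I_(r + s) -> fps (r + s) F :=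
  fun k => match split k with
           | inl i => fps_comp (phi k) (unstraighten f)
                      - fps_comp (f i) (conj_tail phi f)
           | inr j => conj_tail phi f j
           end.

Definition linear_fixed phi : Prop :=
  forall i : 'I_r, fps_comp (phi (lshift s i)) (graph (fun=> 0)) = 0.

End Subvariety.

Definition formal_conjugacy (n : nat) (h phi psi : 'I_n -> fps n F) : Prop :=
  no_const h /\
  (exists g : 'I_n -> fps n F,
     [/\ no_const g, map_comp h g =1 @fps_var n F
       & map_comp g h =1 @fps_var n F]) /\
  map_comp h phi =1 map_comp psi h.

End FormalMaps.

(* Main.v *)
(* Comparing coefficients of x^u in the i-th invariance equation gives
     (lambda_i - mu^u) f_{i,u} = (terms in earlier coefficients),
   where mu = (lambda_{r+1}, ..., lambda_n): the linear part of phi is upper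
   triangular, so the other coefficients f_{j,v} involved have smaller degree,
   or the same degree and smaller weight sum_j j v_j, or v = u and j > i.  As
   u <> 0, the factor lambda_i - mu^u is nonzero, so the f_{i,u} exist and are
   unique by well-founded recursion.  The conjugacy statements are then formal
   consequences of the associativity of composition. *)

Require Import Defs.
From HB Require Import structures.
From mathcomp Require Import all_boot all_order all_algebra.
From mathcomp Require Import boolp zify.
From mathcomp Require Import mpoly.

Set Implicit Arguments.
Unset Strict Implicit.
Unset Printing Implicit Defensive.

Import GRing.Theory.
Local Open Scope ring_scope.

Arguments fps_mul : simpl never.
Arguments fps_comp : simpl never.

(** * Composition of formal power series *)

Section Coefficients.
Variables (n : nat) (R : comNzRingType).
Implicit Types (f g : fps n R) (p q : {mpoly R[n]}) (m : 'X_{1..n}).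

Lemma fcoef1 m : fcoef (1 : fps n R) m = (m == 0%MM)%:R. Proof. by []. Qed.
Lemma fcoefD f g m : fcoef (f + g) m = fcoef f m + fcoef g m.
Proof. by []. Qed.
Lemma fcoefB f g m : fcoef (f - g) m = fcoef f m - fcoef g m.
Proof. by []. Qed.

Lemma fcoefM f g m : fcoef (f * g) m =
  \sum_(k : 'X_{1..n < (mdeg m).+1, (mdeg m).+1} | m == (k.1 + k.2)%MM)
     fcoef f k.1 * fcoef g k.2.
Proof. by []. Qed.

Lemma fcoef_var (i : 'I_n) m : fcoef (fps_var R i) m = (m == U_(i)%MM)%:R.
Proof. by []. Qed.

Lemma fcoef_sum (I : Type) (l : seq I) (P : pred I) (F : I -> fps n R) m :
  fcoef (\sum_(i <- l | P i) F i) m = \sum_(i <- l | P i) fcoef (F i) m.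
Proof. exact: (big_morph (fun f => fcoef f m) (fun f g => fcoefD f g m)). Qed.

Definition fps_of_mpoly p : fps n R := FPS (fun m => p@_m).

Fact fps_of_mpoly_is_additive : additive fps_of_mpoly.
Proof. by move=> p q; apply: fpsP => m; rewrite /= mcoeffB. Qed.

Fact fps_of_mpoly_is_multiplicative : multiplicative fps_of_mpoly.
Proof.
split=> [p q|]; apply: fpsP => m; last by rewrite /= mcoeff1.
by rewrite fcoefM /= mcoeffM.
Qed.

HB.instance Definition _ :=
  GRing.isAdditive.Build {mpoly R[n]} (fps n R) fps_of_mpoly
    fps_of_mpoly_is_additive.
HB.instance Definition _ :=
  GRing.isMultiplicative.Build {mpoly R[n]} (fps n R) fps_of_mpoly
    fps_of_mpoly_is_multiplicative.

Lemma fps_of_mpolyX i : fps_of_mpoly 'X_i = fps_var R i.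
Proof. by apply: fpsP => m; rewrite /= mcoeffX eq_sym. Qed.

(** Factoring through polynomials lets constants inherit the ring morphism structure. *)
Definition fpsC : R -> fps n R := fps_of_mpoly \o @mpolyC n R.

HB.instance Definition _ := GRing.RMorphism.on fpsC.

Lemma fcoefC c m : fcoef (fpsC c) m = c * (m == 0%MM)%:R.
Proof. by rewrite /= mcoeffC. Qed.

(** Congruence modulo the [d]-th power of the ideal generated by the variables. *)
Definition eqdeg d f g := forall m, (mdeg m < d)%N -> fcoef f m = fcoef g m.

Lemma eqdeg_trunc d f : eqdeg d (fps_of_mpoly (fps_trunc d f)) f.
Proof. by move=> m md; rewrite /= mcoeff_trunc. Qed.

Lemma eqdegM d f f' g g' :
  eqdeg d f f' -> eqdeg d g g' -> eqdeg d (f * g) (f' * g').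
Proof.
move=> ff' gg' m md; rewrite !fcoefM.
apply: eq_bigr => -[[k1 h1] [k2 h2]] _ /=.
by rewrite ff' ?gg' // (leq_trans _ md).
Qed.

Lemma eqdegX d f f' k : eqdeg d f f' -> eqdeg d (f ^+ k) (f' ^+ k).
Proof. by move=> ff'; elim: k => // k IHk; rewrite !exprS; apply: eqdegM. Qed.

Lemma eqdeg_prod (I : Type) (l : seq I) d (F G : I -> fps n R) :
  (forall i, eqdeg d (F i) (G i)) ->
  eqdeg d (\prod_(i <- l) F i) (\prod_(i <- l) G i).
Proof.
move=> FG; elim: l => [|i l IHl]; first by rewrite !big_nil.
by rewrite !big_cons; apply: eqdegM.
Qed.

Lemma fcoefCM c f m : fcoef (fpsC c * f) m = c * fcoef f m.
Proof.
rewrite (@eqdegM (mdeg m).+1 _ (fpsC c)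
  _ (fps_of_mpoly (fps_trunc (mdeg m).+1 f))) //.
- by rewrite -[fpsC c]/(fps_of_mpoly _) -rmorphM /= mcoeffCM mcoeff_trunc.
- by move=> k km; rewrite eqdeg_trunc.
Qed.

Lemma fcoefM_eq0 a b f g m :
    eqdeg a f 0 -> eqdeg b g 0 -> (mdeg m < a + b)%N ->
  fcoef (f * g) m = 0.
Proof.
move=> f0 g0 md; rewrite fcoefM big1 // => -[[k1 h1] [k2 h2]] /= /eqP mE.
have [k1a|k1a] := ltnP (mdeg k1) a; first by rewrite f0 // mul0r.
rewrite g0 ?mulr0 // -(ltn_add2l (mdeg k1)) -mdegD -mE (leq_trans md) //.
by rewrite leq_add2r.
Qed.

Lemma eqdegX_eq0 f k : fcoef f 0%MM = 0 -> eqdeg k (f ^+ k) 0.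
Proof.
move=> f0; elim: k => [|k IHk] m //; rewrite exprS => mk.
apply: (@fcoefM_eq0 1 k) => // u; rewrite ltnS leqn0 mdeg_eq0 => /eqP ->.
by rewrite f0.
Qed.

End Coefficients.

Section Composition.
Variables (n m : nat) (R : comNzRingType).
Implicit Types (f g : fps n R) (h : 'I_n -> fps m R) (p q : {mpoly R[n]}).

Definition zero_const h := forall i, fcoef (h i) 0%MM = 0.

(** A product of [mdeg k] series without constant term vanishes to order [mdeg k]; this is what
    makes composition a finite sum in each degree. *)
Lemma mmap1_eqdeg0 h (k : 'X_{1..n}) :
  zero_const h -> eqdeg (mdeg k) (mmap1 h k) 0.
Proof.
move=> h0; rewrite /mmap1 mdegE.
elim: (index_enum _) => [|i l IHl]; first by rewrite !big_nil.
rewrite !big_cons => u uk; apply: (@fcoefM_eq0 _ _ (k i)) uk => //.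
exact: eqdegX_eq0.
Qed.

Lemma mmap_eqdeg h d p q : zero_const h ->
    eqdeg d (fps_of_mpoly p) (fps_of_mpoly q) ->
  eqdeg d (mmap (@fpsC m R) h p) (mmap (@fpsC m R) h q).
Proof.
move=> h0 pq u ud; apply/eqP; rewrite -subr_eq0 -fcoefB -raddfB /=.
rewrite /mmap fcoef_sum big1 // => k _; rewrite fcoefCM.
have [kd|kd] := ltnP (mdeg k) d.
  by move: (pq k kd) => /= pqk; rewrite mcoeffB pqk subrr mul0r.
by rewrite mmap1_eqdeg0 ?mulr0 // (leq_trans ud).
Qed.

(** The bridge to polynomials: each coefficient of a composition is that of a polynomial evaluation,
    so the algebraic laws can be read off from the ring morphism [mmap]. *)
Lemma fcoef_comp f h d p u :
    zero_const h -> eqdeg d (fps_of_mpoly p) f -> (mdeg u < d)%N ->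
  fcoef (fps_comp f h) u = fcoef (mmap (@fpsC m R) h p) u.
Proof.
move=> h0 pf ud.
rewrite (@mmap_eqdeg _ (mdeg u).+1 _ (fps_trunc (mdeg u).+1 f)) //.
  rewrite /fps_trunc raddf_sum /= fcoef_sum; apply: eq_bigr => k _.
  by rewrite mmapZ mmapX fcoefCM.
by move=> k ku; rewrite eqdeg_trunc // pf // (leq_trans ku).
Qed.

Lemma fps_comp_eqdeg f g h d :
  eqdeg d f g -> eqdeg d (fps_comp f h) (fps_comp g h).
Proof.
move=> fg u ud; apply: eq_bigr => -[k ku] _ /=.
by rewrite fg // (leq_trans ku).
Qed.

Lemma fps_comp_eqdegr f h h' d :
    (forall i, eqdeg d (h i) (h' i)) ->
  eqdeg d (fps_comp f h) (fps_comp f h').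
Proof.
move=> hh' u ud; apply: eq_bigr => k _; congr (_ * _).
by apply: (eqdeg_prod _ _ ud) => i; apply: eqdegX.
Qed.

Lemma fps_comp_mpoly p h : zero_const h ->
  fps_comp (fps_of_mpoly p) h = mmap (@fpsC m R) h p.
Proof. by move=> h0; apply: fpsP => u; apply: fcoef_comp (ltnSn _). Qed.

Lemma fps_compB f g h : fps_comp (f - g) h = fps_comp f h - fps_comp g h.
Proof.
apply: fpsP => u; rewrite fcoefB -sumrB; apply: eq_bigr => k _.
by rewrite -mulrBl.
Qed.

Lemma fps_compD f g h : fps_comp (f + g) h = fps_comp f h + fps_comp g h.
Proof.
apply: fpsP => u; rewrite fcoefD -big_split; apply: eq_bigr => k _.
by rewrite mulrDl.
Qed.

Lemma fps_comp0 h : fps_comp 0 h = 0.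
Proof. by apply: fpsP => u; apply: big1 => k _; rewrite mul0r. Qed.

Lemma fps_compM f g h : zero_const h ->
  fps_comp (f * g) h = fps_comp f h * fps_comp g h.
Proof.
move=> h0; apply: fpsP => u; set d := (mdeg u).+1.
(* The product of the truncations need not be the truncation of [f * g], but the two agree below
   degree [d], which is enough. *)
rewrite (@fcoef_comp _ _ d (fps_trunc d f * fps_trunc d g)) //; last first.
  by rewrite rmorphM; apply: eqdegM; apply: eqdeg_trunc.
rewrite rmorphM; refine (@eqdegM _ _ d _ _ _ _ _ _ u (ltnSn _)) => v vd.
  by rewrite (fcoef_comp h0 (@eqdeg_trunc _ _ d f)).
by rewrite (fcoef_comp h0 (@eqdeg_trunc _ _ d g)).
Qed.

Lemma fps_compC c h : zero_const h -> fps_comp (fpsC n c) h = fpsC m c.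
Proof. by move=> h0; rewrite fps_comp_mpoly // mmapC. Qed.

Lemma fps_comp_var i h : zero_const h -> fps_comp (fps_var R i) h = h i.
Proof. by move=> h0; rewrite -fps_of_mpolyX fps_comp_mpoly // mmapX mmap1U. Qed.

Lemma fps_compX f h k : zero_const h -> fps_comp (f ^+ k) h = fps_comp f h ^+ k.
Proof.
move=> h0; elim: k => [|k IHk]; last by rewrite !exprS fps_compM ?IHk.
by rewrite !expr0 -(rmorph1 (@fpsC n R)) fps_compC // rmorph1.
Qed.

Lemma fps_comp_prod (I : Type) (l : seq I) (F : I -> fps n R) h :
  zero_const h ->
  fps_comp (\prod_(i <- l) F i) h = \prod_(i <- l) fps_comp (F i) h.
Proof.
move=> h0; elim: l => [|i l IHl]; last by rewrite !big_cons fps_compM ?IHl.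
by rewrite !big_nil -[1](expr0 1) fps_compX.
Qed.

Lemma fps_comp_sum (I : Type) (l : seq I) (F : I -> fps n R) h :
  fps_comp (\sum_(i <- l) F i) h = \sum_(i <- l) fps_comp (F i) h.
Proof.
by apply: (big_morph (fun f => fps_comp f h)) => [f g|];
  rewrite (fps_compD, fps_comp0).
Qed.

Lemma fps_comp_const f h :
  zero_const h -> fcoef (fps_comp f h) 0%MM = fcoef f 0%MM.
Proof.
move=> h0; rewrite (@fcoef_comp _ _ 1 (fcoef f 0%MM)%:MP) ?mdeg0 //.
  by rewrite mmapC fcoefC eqxx mulr1.
move=> u; rewrite ltnS leqn0 mdeg_eq0 => /eqP ->.
by rewrite /= mcoeffC eqxx mulr1.
Qed.

End Composition.

(** In a given degree only a truncation of [f] matters, and for a polynomial the claim holds because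
    composition with [h] respects sums, products and constants. *)
Lemma fps_compA (n m l : nat) (R : comNzRingType) (f : fps n R)
    (g : 'I_n -> fps m R) (h : 'I_m -> fps l R) :
    zero_const g -> zero_const h ->
  fps_comp (fps_comp f g) h = fps_comp f (fun i => fps_comp (g i) h).
Proof.
move=> g0 h0; have gh0 : zero_const (fun i => fps_comp (g i) h).
  by move=> i; rewrite fps_comp_const.
apply: fpsP => u; set d := (mdeg u).+1; set p := fps_trunc d f.
rewrite (@fps_comp_eqdeg _ _ _ _ (mmap (@fpsC m R) g p) _ d) //; last first.
  by move=> v vd; apply: (fcoef_comp g0 (@eqdeg_trunc _ _ d f)).
rewrite (fcoef_comp gh0 (@eqdeg_trunc _ _ d f)) // /mmap fps_comp_sum.
rewrite !fcoef_sum; apply: eq_bigr => k _.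
rewrite fps_compM // fps_compC // fps_comp_prod //; congr (fcoef (_ * _) _).
by apply: eq_bigr => i _; rewrite fps_compX.
Qed.

Lemma fps_comp_id (n : nat) (R : comNzRingType) (f : fps n R) :
  fps_comp f (@fps_var n R) = f.
Proof.
have v0 : zero_const (@fps_var n R).
  by move=> i; rewrite fcoef_var eq_sym mnm1_eq0.
apply: fpsP => u; rewrite (fcoef_comp v0 (@eqdeg_trunc _ _ (mdeg u).+1 f)) //.
suff -> p : mmap (@fpsC n R) (@fps_var n R) p = fps_of_mpoly p.
  exact: eqdeg_trunc.
elim/mpolyind: p => [|c k p _ _ IHp]; first by rewrite !raddf0.
rewrite !raddfD /= IHp mmapZ mmapX -mul_mpolyC rmorphM; congr (_ * _ + _).
rewrite mpolyXE_id rmorph_prod; apply: eq_bigr => i _.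
by rewrite rmorphXn /= fps_of_mpolyX.
Qed.

(** * Lowest order terms *)

Section LinearPart.
Variables (n m : nat) (R : comNzRingType).
Implicit Types (f : fps n R) (h : 'I_n -> fps m R).

(** The constant term is kept, so that this represents [f] modulo terms of degree at least 2. *)
Definition linear_part f : {mpoly R[n]} :=
  (fcoef f 0%MM)%:MP + \sum_(j < n) fcoef f U_(j)%MM *: 'X_j.

Lemma eqdeg_linear_part f : eqdeg 2 (fps_of_mpoly (linear_part f)) f.
Proof.
move=> k k2; rewrite /= /linear_part mcoeffD mcoeffC raddf_sum /=.
under eq_bigr do rewrite mcoeffZ mcoeffX.
have [k0|k0] := eqVneq (mdeg k) 0%N.
  move/eqP: k0; rewrite mdeg_eq0 => /eqP ->; rewrite eqxx mulr1 big1 ?addr0 //.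
  by move=> j _; rewrite mnm1_eq0 mulr0.
have /mdeg1P[j /eqP ->] : mdeg k == 1%N by lia.
rewrite mnm1_eq0 mulr0 add0r (bigD1 j) //= eqxx mulr1 big1 ?addr0 // => i ij.
by rewrite eq_mnm1 (negPf ij) mulr0.
Qed.

Lemma mmap_linear_part f h : mmap (@fpsC m R) h (linear_part f) =
  fpsC m (fcoef f 0%MM) + \sum_(j < n) fpsC m (fcoef f U_(j)%MM) * h j.
Proof.
rewrite raddfD /= mmapC raddf_sum; congr (_ + _); apply: eq_bigr => j _.
by rewrite /= mmapZ mmapX mmap1U.
Qed.

Lemma fcoef_comp_linear f h l : zero_const h ->
  fcoef (fps_comp f h) U_(l)%MM =
  \sum_(j < n) fcoef f U_(j)%MM * fcoef (h j) U_(l)%MM.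
Proof.
move=> h0; rewrite (fcoef_comp h0 (@eqdeg_linear_part f)) ?mdeg1 //.
rewrite mmap_linear_part fcoefD fcoefC mnm1_eq0 mulr0 add0r fcoef_sum.
by apply: eq_bigr => j _; rewrite fcoefCM.
Qed.

(** In ab - a'b' = (a - a')b + a'(b - b'), each summand has a factor of order [d] and one without
    constant term, which gains a degree. *)
Lemma eqdegMS d (a a' b b' : fps m R) :
    fcoef a' 0%MM = 0 -> fcoef b 0%MM = 0 ->
    eqdeg d a a' -> eqdeg d b b' ->
  eqdeg d.+1 (a * b) (a' * b').
Proof.
move=> a0 b0 aa' bb' u ud; apply/eqP; rewrite -subr_eq0 -fcoefB.
have -> : a * b - a' * b' = (a - a') * b + a' * (b - b').
  by rewrite mulrBl mulrBr addrA subrK.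
have deg0 (c : fps m R) : fcoef c 0%MM = 0 -> eqdeg 1 c 0.
  by move=> c0 v; rewrite ltnS leqn0 mdeg_eq0 => /eqP ->; rewrite c0.
have degB (c c' : fps m R) : eqdeg d c c' -> eqdeg d (c - c') 0.
  by move=> cc' v vd; rewrite fcoefB cc' // subrr.
by rewrite fcoefD (@fcoefM_eq0 _ _ d 1) ?(@fcoefM_eq0 _ _ 1 d) ?addr0 ?addn1;
  auto.
Qed.

(** Split one variable off [k]: since [mdeg k] is at least 2, the cofactor still has no constant
    term, and [eqdegMS] applies. *)
Lemma mmap1_eqdegS h h' d (k : 'X_{1..n}) :
    zero_const h -> zero_const h' -> (forall i, eqdeg d (h i) (h' i)) ->
    (1 < mdeg k)%N ->
  eqdeg d.+1 (mmap1 h k) (mmap1 h' k).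
Proof.
move=> h0 h'0 hh' k1.
have [i ki] : exists i, (0 < k i)%N.
  apply/existsP; apply: contraLR k1 => /existsPn k0.
  rewrite mdegE big1 // => i _.
  by move: (k0 i); lia.
have Uk : (U_(i) <= k)%MM.
  by apply/mnm_lepP => j; rewrite mnm1E; case: eqP => // <-.
rewrite -(submK Uk) addmC !commr_mmap1_M; try by move=> *; apply: mulrC.
rewrite !mmap1U; apply: eqdegMS => //.
  rewrite (mmap1_eqdeg0 h0) // mdeg0.
  by have := congr1 mdeg (submK Uk); rewrite mdegD mdeg1; lia.
by apply: eqdeg_prod => j; apply: eqdegX.
Qed.

(* Only the linear terms of f see a change of its arguments in the lowest
   degree d: all other monomials have degree at least 2. *)
Lemma fcoef_comp_sub f h h' d u :
    zero_const h -> zero_const h' -> (forall i, eqdeg d (h i) (h' i)) ->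
    (mdeg u <= d)%N ->
  fcoef (fps_comp f h) u - fcoef (fps_comp f h') u =
  \sum_(j < n) fcoef f U_(j)%MM * (fcoef (h j) u - fcoef (h' j) u).
Proof.
move=> h0 h'0 hh' ud.
(* [q] has only terms of degree at least 2, so its compositions with [h] and [h'] agree up to degree
   [d]. *)
pose q := f - fps_of_mpoly (linear_part f).
have qE h1 : fps_comp f h1 =
    fps_comp (fps_of_mpoly (linear_part f)) h1 + fps_comp q h1.
  by rewrite -fps_compD addrC subrK.
rewrite !qE !fcoefD.
have -> : fcoef (fps_comp q h) u = fcoef (fps_comp q h') u.
  apply: eq_bigr => -[k ku] _ /=; have [k2|k2] := ltnP (mdeg k) 2.
    rewrite (@eqdeg_linear_part f k k2 : (linear_part f)@_k = _).
    by rewrite subrr !mul0r.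
  by congr (_ * _); apply: (mmap1_eqdegS h0 h'0 hh' k2).
rewrite opprD addrACA subrr addr0 !fps_comp_mpoly // !mmap_linear_part !fcoefD.
rewrite opprD addrACA subrr add0r !fcoef_sum -sumrB.
by apply: eq_bigr => j _; rewrite !fcoefCM mulrBr.
Qed.

End LinearPart.

(** * Leading monomials for the order by degree and weight *)

Section Leading.
Variable s : nat.
Implicit Types u v k l : 'X_{1..s}.

(** Replacing a variable by one of larger index raises the weight. Indices start at 0, which only
    shifts weights by a constant in each degree. *)
Definition weight u : nat := \sum_(i < s) i * u i.

Lemma weightD u v : weight (u + v) = (weight u + weight v)%N.
Proof.
by rewrite -big_split; apply: eq_bigr => i _; rewrite mnmDE mulnDr.
Qed.

Lemma weight1 (i : 'I_s) : weight U_(i) = i.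
Proof.
rewrite /weight (bigD1 i) //= mnm1E eqxx muln1 big1 ?addn0 // => j ji.
by rewrite mnm1E eq_sym (negPf ji) muln0.
Qed.

(* An upper triangular change of variables moves monomials up in this order. *)
Definition mnm_prec u v : bool :=
  (mdeg u < mdeg v)%N || (mdeg u == mdeg v) && (weight u < weight v)%N.

Lemma mnm_prec_irr u : mnm_prec u u = false.
Proof. by rewrite /mnm_prec; lia. Qed.

Lemma mnm_precD k l u v :
    (u == k) || mnm_prec k u -> (v == l) || mnm_prec l v ->
  ((u == k) && (v == l)) || mnm_prec (k + l) (u + v).
Proof.
rewrite /mnm_prec !mdegD !weightD.
by case: (u =P k) => [->|_]; case: (v =P l) => [->|_] /=; lia.
Qed.

Variable R : comNzRingType.
Implicit Types f g : fps s R.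

(** The value [c] may be 0, since multipliers may vanish. The order is partial: other monomials with
    the degree and weight of [k] must not occur. *)
Definition leads k (c : R) f : Prop :=
  fcoef f k = c /\
  forall u, fcoef f u != 0 -> (u == k) || mnm_prec k u.

Lemma leads1 : leads 0%MM 1 (1 : fps s R).
Proof.
split=> [|u]; rewrite fcoef1 ?eqxx //.
by case: (u =P _) => //; rewrite eqxx.
Qed.

(** Strictness in either factor makes the product strictly larger, so the pair [(k, l)] alone
    contributes to [k + l]. *)
Lemma leadsM k l a b f g :
  leads k a f -> leads l b g -> leads (k + l)%MM (a * b) (f * g).
Proof.
move=> [fk f0] [gl g0].
have fg0 u v : fcoef f u * fcoef g v != 0 ->
    ((u == k) && (v == l)) || mnm_prec (k + l) (u + v).
  move=> fg; apply: mnm_precD; [apply: f0 | apply: g0].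
    by apply: contraNneq fg => ->; rewrite mul0r.
  by apply: contraNneq fg => ->; rewrite mulr0.
split=> [|u].
  have kP : (mdeg k < (mdeg (k + l)).+1)%N by rewrite mdegD ltnS leq_addr.
  have lP : (mdeg l < (mdeg (k + l)).+1)%N by rewrite mdegD ltnS leq_addl.
  rewrite fcoefM (bigD1 (BMultinom kP, BMultinom lP)) //= fk gl.
  rewrite big1 ?addr0 // => -[x y] /= /andP[/eqP xy ne].
  apply/eqP; apply: contraNT ne => /fg0; rewrite -xy mnm_prec_irr orbF.
  by case/andP => /eqP xk /eqP yl; rewrite xpair_eqE -!val_eqE /= xk yl !eqxx.
rewrite fcoefM => /eqP fgu.
have [/existsP[x /andP[/eqP ux /fg0]]|/existsPn nx] := boolP
    [exists x : 'X_{1..s < (mdeg u).+1, (mdeg u).+1},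
       (u == (x.1 + x.2)%MM) && (fcoef f x.1 * fcoef g x.2 != 0)].
  by rewrite -ux => /orP[/andP[/eqP xk /eqP xl]|->];
    rewrite ?orbT // {1}ux xk xl eqxx.
case: fgu; apply: big1 => x ux; apply/eqP; move: (nx x).
by rewrite ux /= negbK.
Qed.

Lemma leadsX k a f e : leads k a f -> leads (k *+ e)%MM (a ^+ e) (f ^+ e).
Proof.
move=> fk; elim: e => [|e IHe]; first by rewrite mulm0n !expr0; apply: leads1.
by rewrite mulmS !exprS; apply: leadsM.
Qed.

(** This produces the monomial in the multipliers that appears in the nonresonance condition. *)
Lemma leads_mmap1 (b : 'I_s -> fps s R) (mu : 'I_s -> R) k :
    (forall j, leads U_(j)%MM (mu j) (b j)) ->
  leads k (\prod_(j < s) mu j ^+ k j) (mmap1 b k).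
Proof.
move=> bP; rewrite {1}[k]multinomUE_id /mmap1.
elim: (index_enum _) => [|j l IHl]; first by rewrite !big_nil; apply: leads1.
by rewrite !big_cons; apply: leadsM => //; apply: leadsX.
Qed.

(** In degree 1 the weight is the index of the variable, so the vanishing for [l < j] leaves only
    monomials above; higher degrees are above anyway. *)
Lemma leads_triangular f (j : 'I_s) (c : R) :
    fcoef f 0%MM = 0 -> fcoef f U_(j)%MM = c ->
    (forall l : 'I_s, (l < j)%N -> fcoef f U_(l)%MM = 0) ->
  leads U_(j)%MM c f.
Proof.
move=> f0 fj fl; split=> // u fu; rewrite /mnm_prec mdeg1 weight1.
have: mdeg u != 0%N by rewrite mdeg_eq0; apply: contraNneq fu => ->; rewrite f0.
have [/mdeg1P[l /eqP uE] _|] := boolP (mdeg u == 1%N); last by lia.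
rewrite uE in fu *; rewrite eq_mnm1 mdeg1 weight1 -val_eqE /=.
have: ~~ (l < j)%N by apply: contraNN fu => /fl ->.
by lia.
Qed.

End Leading.

(** Entries between distinct blocks vanish; within a block, [j < i] passes to the local indices,
    where a Jordan block has only its diagonal and superdiagonal. *)
Lemma jordan_upper (F : fieldType) (n : nat) (A : 'M[F]_n) (i j : 'I_n) :
  jordan_form A -> (j < i)%N -> A i j = 0.
Proof.
case=> k [p [c [pn [_ ->]]]]; case: _ / pn i j => i j; rewrite castmx_id.
rewrite -(tagnat.sig2K i) -(tagnat.sig2K j).
move: (tagnat.sig1 i) (tagnat.sig1 j) (tagnat.sig2 i) (tagnat.sig2 j).
move=> {i j} b b' i j ji.
set D := mxdiag _; have -> : D (tagnat.Rank b i) (tagnat.Rank b' j) =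
  submxblock D b b' i j by rewrite [RHS]mxE; reflexivity.
rewrite mxblockK; case: eqVneq => [bb'|]; last by rewrite mxE.
case: _ / bb' j ji => j; rewrite conform_mx_id !tagnat.RankEsum ltn_add2l => ji.
by rewrite mxE; do 2 (case: eqP => [|_]; first by lia).
Qed.

(** * Straightening a graph *)

Lemma zero_const_var (n m : nat) (R : comNzRingType) (h : 'I_n -> 'I_m) :
  zero_const (fun i => fps_var R (h i)).
Proof. by move=> i; rewrite fcoef_var eq_sym mnm1_eq0. Qed.

Lemma ord_sumP (r s : nat) (P : 'I_(r + s) -> Prop) :
  (forall i, P (lshift s i)) -> (forall j, P (rshift r j)) -> forall k, P k.
Proof. by move=> Pl Pr k; case: (split_ordP k) => i ->. Qed.

Section Graph.
Variables (F : fieldType) (r s : nat) (f : 'I_r -> fps s F).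

Lemma graph_lshift i : graph f (lshift s i) = f i.
Proof. by rewrite /graph; have /= -> := unsplitK (inl i : 'I_r + 'I_s). Qed.

Lemma graph_rshift j : graph f (rshift r j) = fps_var F j.
Proof. by rewrite /graph; have /= -> := unsplitK (inr j : 'I_r + 'I_s). Qed.

Lemma zero_const_graph : zero_const f -> zero_const (graph f).
Proof.
move=> f0; apply: ord_sumP => [i|j]; first by rewrite graph_lshift f0.
by rewrite graph_rshift (zero_const_var F id).
Qed.

End Graph.

Section Straightening.
Variables (F : fieldType) (r s : nat) (f : 'I_r -> fps s F).

Lemma straighten_lshift i :
  straighten f (lshift s i) = fps_var F (lshift s i) - lift_tail f i.
Proof.
by rewrite /straighten; have /= -> := unsplitK (inl i : 'I_r + 'I_s).
Qed.

Lemma straighten_rshift j :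
  straighten f (rshift r j) = fps_var F (rshift r j).
Proof.
by rewrite /straighten; have /= -> := unsplitK (inr j : 'I_r + 'I_s).
Qed.

Lemma unstraighten_lshift i :
  unstraighten f (lshift s i) = fps_var F (lshift s i) + lift_tail f i.
Proof.
by rewrite /unstraighten; have /= -> := unsplitK (inl i : 'I_r + 'I_s).
Qed.

Lemma unstraighten_rshift j :
  unstraighten f (rshift r j) = fps_var F (rshift r j).
Proof.
by rewrite /unstraighten; have /= -> := unsplitK (inr j : 'I_r + 'I_s).
Qed.

Lemma conjugated_lshift phi i : conjugated phi f (lshift s i) =
  fps_comp (phi (lshift s i)) (unstraighten f)
  - fps_comp (f i) (conj_tail phi f).
Proof.
by rewrite /conjugated; have /= -> := unsplitK (inl i : 'I_r + 'I_s).
Qed.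

Lemma conjugated_rshift phi j :
  conjugated phi f (rshift r j) = conj_tail phi f j.
Proof.
by rewrite /conjugated; have /= -> := unsplitK (inr j : 'I_r + 'I_s).
Qed.

Hypothesis f0 : zero_const f.

Lemma lift_tail_comp m (h : 'I_(r + s) -> fps m F) i : zero_const h ->
  fps_comp (lift_tail f i) h = fps_comp (f i) (fun j => h (rshift r j)).
Proof.
move=> h0; rewrite fps_compA //; last exact: zero_const_var.
by congr fps_comp; apply: funext => j; rewrite fps_comp_var.
Qed.

Lemma lift_tail_const i : fcoef (lift_tail f i) 0%MM = 0.
Proof. by rewrite fps_comp_const //; apply: zero_const_var. Qed.

Lemma zero_const_straighten : zero_const (straighten f).
Proof.
apply: ord_sumP => [i|j].
  by rewrite straighten_lshift fcoefB lift_tail_const subr0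
             (zero_const_var F id).
by rewrite straighten_rshift (zero_const_var F id).
Qed.

Lemma zero_const_unstraighten : zero_const (unstraighten f).
Proof.
apply: ord_sumP => [i|j].
  by rewrite unstraighten_lshift fcoefD lift_tail_const addr0
             (zero_const_var F id).
by rewrite unstraighten_rshift (zero_const_var F id).
Qed.

(** Neither map moves the last [s] variables, so [lift_tail f i] is unchanged by the substitution
    and cancels. *)
Lemma straightenK :
  Defs.map_comp (straighten f) (unstraighten f) =1 @fps_var (r + s) F.
Proof.
have u0 := zero_const_unstraighten.
apply: ord_sumP => [i|j]; rewrite /Defs.map_comp.
  rewrite straighten_lshift fps_compB fps_comp_var // lift_tail_comp //.
  rewrite (funext unstraighten_rshift) unstraighten_lshift.
  exact: addrK.
by rewrite straighten_rshift fps_comp_var // unstraighten_rshift.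
Qed.

Lemma unstraightenK :
  Defs.map_comp (unstraighten f) (straighten f) =1 @fps_var (r + s) F.
Proof.
have u0 := zero_const_straighten.
apply: ord_sumP => [i|j]; rewrite /Defs.map_comp.
  rewrite unstraighten_lshift fps_compD fps_comp_var // lift_tail_comp //.
  rewrite (funext straighten_rshift) straighten_lshift.
  exact: subrK.
by rewrite unstraighten_rshift fps_comp_var // straighten_rshift.
Qed.

(** Geometrically, [unstraighten f] carries the linear subvariety onto the graph of [f]. *)
Lemma unstraighten_axis k :
  fps_comp (unstraighten f k) (graph (fun=> 0)) = graph f k.
Proof.
have g0 : zero_const (graph (fun _ : 'I_r => 0 : fps s F)).
  exact: zero_const_graph.
move: k; apply: ord_sumP => [i|j].
  rewrite unstraighten_lshift fps_compD fps_comp_var // graph_lshift add0r.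
  rewrite lift_tail_comp // (funext (graph_rshift _)) fps_comp_id.
  by rewrite graph_lshift.
by rewrite unstraighten_rshift fps_comp_var // !graph_rshift.
Qed.

Variable phi : 'I_(r + s) -> fps (r + s) F.
Hypothesis phi0 : zero_const phi.

Lemma zero_const_conj_tail : zero_const (conj_tail phi f).
Proof.
by move=> j; rewrite fps_comp_const //; apply: zero_const_unstraighten.
Qed.

(** Restricted to the linear subvariety, the first [r] components become the two sides of the
    invariance equation, subtracted. *)
Lemma conjugated_linear_fixed :
  fixed_under phi f -> linear_fixed (conjugated phi f).
Proof.
move=> fixf i; have g0 := zero_const_unstraighten.
have a0 : zero_const (graph (fun _ : 'I_r => 0 : fps s F)).
  exact: zero_const_graph.
rewrite conjugated_lshift fps_compB !fps_compA //; last first.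
  exact: zero_const_conj_tail.
rewrite (funext unstraighten_axis) fixf; apply/eqP; rewrite subr_eq0; apply/eqP.
congr fps_comp; apply: funext => j.
by rewrite /conj_tail fps_compA // (funext unstraighten_axis).
Qed.

(** Composing the conjugated map with [straighten f] cancels every inner [unstraighten f], leaving
    the components of [phi] corrected by [f]. *)
Lemma conjugated_conjugacy :
  formal_conjugacy (straighten f) phi (conjugated phi f).
Proof.
have u0 := zero_const_unstraighten; have h0 := zero_const_straighten.
split; first exact: h0.
split.
  by exists (unstraighten f); split; [|exact: straightenK|exact: unstraightenK].
have compK k :
    fps_comp (fps_comp (phi k) (unstraighten f)) (straighten f) = phi k.
  rewrite fps_compA //.
  by rewrite (funext unstraightenK : (fun l => fps_comp _ _) = _) fps_comp_id.
apply: ord_sumP => [i|j]; rewrite /Defs.map_comp.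
  rewrite straighten_lshift conjugated_lshift !fps_compB compK fps_comp_var //.
  rewrite lift_tail_comp // fps_compA //; last exact: zero_const_conj_tail.
  by congr (_ - fps_comp _ _); apply: funext => j; rewrite compK.
by rewrite straighten_rshift conjugated_rshift fps_comp_var // compK.
Qed.

End Straightening.

(** * The invariant graph *)

Section WellFoundedFixpoint.
Variables (T V : Type) (prec : rel T) (Phi : (T -> V) -> T -> V).
Hypothesis prec_wf : well_founded prec.
Hypothesis PhiP : forall f g x,
  (forall y, prec y x -> f y = g y) -> Phi f x = Phi g x.

Lemma wf_fixpoint_exists (v0 : V) : exists f, Phi f =1 f.
Proof.
(* Values not below [x] get the default [v0]; by [PhiP] they do not affect [Phi _ x]. *)
pose step x (rec : forall y, prec y x -> V) : V :=
  Phi (fun y => if boolP (prec y x) is AltTrue yx then rec y yx else v0) x.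
exists (Fix prec_wf _ step) => x; rewrite Fix_eq.
  by apply: PhiP => y yx; case: {-}_ / boolP => //; rewrite yx.
move=> y f g fg; congr (Phi _ _); apply: funext => z.
by case: {-}_ / boolP.
Qed.

Lemma wf_fixpoint_unique f g : Phi f =1 f -> Phi g =1 g -> f =1 g.
Proof.
move=> fP gP x; elim/(well_founded_ind prec_wf): x => x IHx.
by rewrite -fP -gP; apply: PhiP.
Qed.

End WellFoundedFixpoint.

(** * Solving the invariance equation coefficient by coefficient *)

Section InvariantGraph.
Variables (F : fieldType) (r s : nat) (phi : 'I_(r + s) -> fps (r + s) F).
Hypothesis phi0 : zero_const phi.
Implicit Types f g : 'I_r -> fps s F.

Definition tail_on_graph f (j : 'I_s) : fps s F :=
  fps_comp (phi (rshift r j)) (graph f).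

Definition defect f (i : 'I_r) : fps s F :=
  fps_comp (phi (lshift s i)) (graph f) - fps_comp (f i) (tail_on_graph f).

Lemma fixed_underE f : fixed_under phi f <-> forall i, defect f i = 0.
Proof.
split=> fP i; apply/eqP; first by rewrite subr_eq0; apply/eqP/fP.
by rewrite -subr_eq0; apply/eqP/fP.
Qed.

Lemma zero_const_tail_on_graph f :
  zero_const f -> zero_const (tail_on_graph f).
Proof.
by move=> f0 j; rewrite fps_comp_const //; apply: zero_const_graph.
Qed.

Lemma zero_const_defect f : zero_const f -> zero_const (defect f).
Proof.
move=> f0 i; have t0 := zero_const_tail_on_graph f0.
have g0 := zero_const_graph f0.
by rewrite fcoefB !fps_comp_const // phi0 f0 subr0.
Qed.

Lemma eqdeg_graph f g d :
  (forall i, eqdeg d (f i) (g i)) -> forall k, eqdeg d (graph f k) (graph g k).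
Proof.
move=> fg; apply: ord_sumP => [i|j]; first by rewrite !graph_lshift.
by rewrite !graph_rshift.
Qed.

Hypothesis phi_upper :
  forall i j : 'I_(r + s), (j < i)%N -> fcoef (phi i) U_(j)%MM = 0.

Let lambda i := fcoef (phi (lshift s i)) U_(lshift s i)%MM.
Let mu j := fcoef (phi (rshift r j)) U_(rshift r j)%MM.

(** By triangularity the last [s] components of [phi] contain none of the first [r] variables
    linearly, so [f] does not enter the linear part on the graph. *)
Lemma leads_tail_on_graph f j :
  zero_const f -> leads U_(j)%MM (mu j) (tail_on_graph f j).
Proof.
move=> f0; have g0 := zero_const_graph f0.
have linE l : fcoef (tail_on_graph f j) U_(l)%MM =
    fcoef (phi (rshift r j)) U_(rshift r l)%MM.
  rewrite fcoef_comp_linear // big_split_ord /= big1 ?add0r => [|i _].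
    rewrite (bigD1 l) //= graph_rshift fcoef_var eqxx mulr1 big1 ?addr0 //.
    move=> t tl; rewrite graph_rshift fcoef_var eq_mnm1 eq_sym (negPf tl).
    exact: mulr0.
  by rewrite phi_upper ?mul0r //= ltn_addr.
apply: leads_triangular => [||l lj]; first exact: zero_const_tail_on_graph.
  exact: linE.
by rewrite linE phi_upper //= ltn_add2l.
Qed.

(** The two graphs differ only in the first [r] arguments, which these components contain only in
    terms of degree at least 2; hence the gain of one degree. *)
Lemma eqdegS_tail_on_graph f g d j :
    zero_const f -> zero_const g -> (forall i, eqdeg d (f i) (g i)) ->
  eqdeg d.+1 (tail_on_graph f j) (tail_on_graph g j).
Proof.
move=> f0 g0 fg u ud; apply/eqP; rewrite -subr_eq0.
rewrite (@fcoef_comp_sub _ _ _ _ _ _ d) //; try exact: zero_const_graph.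
  rewrite big_split_ord /= !big1 ?addr0 // => [k _|k _].
    by rewrite !graph_rshift subrr mulr0.
  by rewrite phi_upper ?mul0r //= ltn_addr.
exact: eqdeg_graph.
Qed.

(** For equal monomials the larger index comes first, because row [i] of the linear part involves
    only the variables of index at least [i]. *)
Definition coef_prec : rel ('I_r * 'X_{1..s}) := fun x y =>
  mnm_prec x.2 y.2 || (x.2 == y.2) && (y.1 < x.1)%N.

(** Lexicographic descent on the degree, the weight and [r - i]. *)
Lemma coef_prec_wf : well_founded coef_prec.
Proof.
have H d w a (i : 'I_r) u : mdeg u = d -> weight u = w -> (r - i)%N = a ->
    Acc coef_prec (i, u).
  elim/ltn_ind: d w a i u => d IHd w; elim/ltn_ind: w => w IHw a.
  elim/ltn_ind: a => a IHa i u ud uw ia; constructor=> -[j v].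
  rewrite /coef_prec /mnm_prec /=.
  case/orP => [/orP[vd|/andP[/eqP vd vw]]|/andP[/eqP -> ij]].
  - by apply: (IHd (mdeg v)) => //; rewrite -ud.
  - by apply: (IHw (weight v)) => //; rewrite -?uw // vd.
  - apply: (IHa (r - j)%N) => //; rewrite -ia.
    by have := ltn_ord j; have := ltn_ord i; lia.
by move=> [i u]; apply: H.
Qed.

(** Taking a difference of two candidates removes the contribution of earlier coefficients without
    having to write it out. *)
Lemma defect_sub f g i u : zero_const f -> zero_const g ->
    (forall j v, coef_prec (j, v) (i, u) -> fcoef (f j) v = fcoef (g j) v) ->
  fcoef (defect f i) u - fcoef (defect g i) u =
  (lambda i - \prod_(j < s) mu j ^+ u j) * (fcoef (f i) u - fcoef (g i) u).
Proof.
move=> f0 g0 fg; set d := mdeg u.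
have fgd j : eqdeg d (f j) (g j).
  by move=> v vd; apply: fg; rewrite /coef_prec /mnm_prec /= -/d vd.
(* Only linear terms see the difference: those with [k < i] vanish by triangularity, those with
   [k > i] by [fg], and [k = i] gives [lambda i]. *)
have top : fcoef (fps_comp (phi (lshift s i)) (graph f)) u -
    fcoef (fps_comp (phi (lshift s i)) (graph g)) u =
    lambda i * (fcoef (f i) u - fcoef (g i) u).
  rewrite (@fcoef_comp_sub _ _ _ _ _ _ d) //; try exact: zero_const_graph.
    rewrite big_split_ord /= [X in _ + X]big1 ?addr0 => [|k _]; last first.
      by rewrite !graph_rshift subrr mulr0.
    rewrite (bigD1 i) //= !graph_lshift big1 ?addr0 // => k ki.
    rewrite !graph_lshift; have [lt_ki|le_ik] := ltnP k i.
      by rewrite phi_upper ?mul0r.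
    rewrite fg ?subrr ?mulr0 // /coef_prec /= eqxx ltn_neqAle le_ik andbT.
    by rewrite eq_sym [_ != _]ki orbT.
  exact: eqdeg_graph.
have sub : fcoef (fps_comp (f i) (tail_on_graph f)) u -
    fcoef (fps_comp (g i) (tail_on_graph g)) u =
    \prod_(j < s) mu j ^+ u j * (fcoef (f i) u - fcoef (g i) u).
  (* Up to degree [d] both inner maps may be taken equal, after which the expression is linear in
     the outer series. *)
  rewrite (@fps_comp_eqdegr _ _ _ _ _ (tail_on_graph g) d.+1) //; last first.
    by move=> j; apply: eqdegS_tail_on_graph.
  rewrite -fcoefB -fps_compB.
  have lead k := leads_mmap1 k (fun j => leads_tail_on_graph j g0).
  transitivity (\sum_(k : 'X_{1..s < d.+1})
    fcoef (f i - g i) k * fcoef (mmap1 (tail_on_graph g) k) u) => //.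
  rewrite (bigD1 (BMultinom (ltnSn d))) //= (lead u).1 mulrC.
  (* A monomial [k] other than [u] reaches [u] only if it precedes it, and there [f i] and [g i]
     agree. *)
  rewrite [X in _ + X]big1 ?addr0 // => -[k kd] /= ku.
  have [->|/(lead k).2] := eqVneq (fcoef (mmap1 (tail_on_graph g) k) u) 0.
    by rewrite mulr0.
  rewrite eq_sym (negPf (ku : k != u)) /= => k_u.
  by rewrite fg ?subrr ?mul0r // /coef_prec /= k_u.
by rewrite mulrBl -top -sub !fcoefB !opprD !opprK [LHS]addrACA.
Qed.

Hypothesis nonresonant :
  forall i u, u != 0%MM -> lambda i != \prod_(j < s) mu j ^+ u j.

(** Forcing the constant term to 0 makes all compositions legitimate for an arbitrary family [c]. *)
Let series (c : 'I_r * 'X_{1..s} -> F) (i : 'I_r) : fps s F :=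
  FPS (fun u => if u == 0%MM then 0 else c (i, u)).

(* The fixed points of this operator are the invariant graphs. *)
Let solve (c : 'I_r * 'X_{1..s} -> F) (x : 'I_r * 'X_{1..s}) : F :=
  if x.2 == 0%MM then 0 else
  c x - fcoef (defect (series c) x.1) x.2 /
        (lambda x.1 - \prod_(j < s) mu j ^+ x.2 j).

Lemma solveE c i u : solve c (i, u) = if u == 0%MM then 0 else
  c (i, u) - fcoef (defect (series c) i) u /
             (lambda i - \prod_(j < s) mu j ^+ u j).
Proof. by []. Qed.

Lemma zero_const_series c : zero_const (series c).
Proof. by move=> i; rewrite /= eqxx. Qed.

(** By [defect_sub] the defect is affine in [c x] with slope equal to the divisor, so [c x] itself
    cancels and only earlier values remain. *)
Lemma solve_local c c' x :
  (forall y, coef_prec y x -> c y = c' y) -> solve c x = solve c' x.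
Proof.
case: x => i u cc'; rewrite !solveE; case: eqVneq => // u0.
apply/eqP; rewrite -subr_eq0 opprD opprK addrACA.
rewrite [X in _ + X]addrC -[X in _ + X]opprB -mulrBl.
rewrite defect_sub; try exact: zero_const_series.
  rewrite mulrAC divff ?mul1r ?subr_eq0 ?nonresonant //=.
  by rewrite (negPf u0).
by move=> j v vu /=; rewrite cc'.
Qed.

Lemma solveP c i u :
  (solve c (i, u) == c (i, u)) =
  (if u == 0%MM then c (i, u) == 0 else fcoef (defect (series c) i) u == 0).
Proof.
rewrite solveE; case: (eqVneq u) => [_|u0]; first by rewrite eq_sym.
rewrite -subr_eq0 addrAC subrr add0r oppr_eq0 mulf_eq0 invr_eq0.
rewrite [lambda i - _ == _]subr_eq0.
by rewrite (negPf (nonresonant _ u0)) orbF.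
Qed.

Lemma invariant_graph_exists : exists f, zero_const f /\ fixed_under phi f.
Proof.
have [c cP] := wf_fixpoint_exists coef_prec_wf solve_local 0.
exists (series c); split; first exact: zero_const_series.
apply/fixed_underE => i; apply: fpsP => u.
(* The fixed point equation gives the coefficients with [u] nonzero; at 0 the defect vanishes
   because no series involved has a constant term. *)
have := solveP c i u; rewrite cP eqxx; case: eqVneq => [->|_ /esym/eqP -> //].
by rewrite zero_const_defect //; apply: zero_const_series.
Qed.

(** The coefficient family of any invariant graph is a fixed point of [solve], and such a fixed
    point is unique. *)
Lemma invariant_graph_unique f g :
    zero_const f -> fixed_under phi f -> zero_const g -> fixed_under phi g ->
  f =1 g.
Proof.
pose coef h (x : 'I_r * 'X_{1..s}) : F := fcoef (h x.1) x.2.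
have coefK h : zero_const h -> series (coef h) = h.
  move=> h0; apply: funext => i; apply: fpsP => u /=.
  by case: eqVneq => // ->; rewrite h0.
have fixP h : zero_const h -> fixed_under phi h ->
    solve (coef h) =1 coef h.
  move=> h0 /fixed_underE hP [i u]; apply/eqP; rewrite solveP coefK //.
  by case: eqVneq => [->|_]; rewrite ?hP // /coef /= h0.
move=> f0 fP g0 gP i; apply: fpsP => u.
exact: (wf_fixpoint_unique coef_prec_wf solve_local (fixP f f0 fP)
  (fixP g g0 gP) (i, u)).
Qed.

End InvariantGraph.

Theorem lemma2p3 (F : fieldType) (r s : nat) (r_gt0 : (0 < r)%N)
    (s_gt0 : (0 < s)%N) (phi : 'I_(r + s) -> fps (r + s) F)
    (phi0 : no_const phi)
    (phiJ : jordan_form (linear_mx phi))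
    (lambda : 'I_(r + s) -> F)
    (lambdaE : forall i, lambda i = linear_mx phi i i)
    (lambdaN : forall i : 'I_r,
       ~ mul_semigroup (fun j : 'I_s => lambda (rshift r j))
           (lambda (lshift s i))) :
  exists f : 'I_r -> fps s F,
    [/\ no_const f /\ fixed_under phi f,
        (forall g : 'I_r -> fps s F,
           no_const g -> fixed_under phi g -> g =1 f),
        formal_conjugacy (straighten f) phi (conjugated phi f)
      & linear_fixed (conjugated phi f)].
Proof.
have upper (i j : 'I_(r + s)) : (j < i)%N -> fcoef (phi i) U_(j)%MM = 0.
  by move=> /(jordan_upper phiJ); rewrite mxE.
have nonres (i : 'I_r) (u : 'X_{1..s}) : u != 0%MM ->
    fcoef (phi (lshift s i)) U_(lshift s i)%MM !=
    \prod_(j < s) fcoef (phi (rshift r j)) U_(rshift r j)%MM ^+ u j.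
  (* A resonance at [u] would place the multiplier in the semigroup, with the entries of [u] as
     exponents; [u] nonzero supplies a positive one. *)
  move=> u0; apply/eqP => res; apply: (lambdaN i); exists u; split.
    apply/existsP; apply: contraNT u0 => /existsPn u0.
    by apply/eqP/mnmP => j; rewrite mnm0E; move: (u0 j); lia.
  rewrite lambdaE mxE res; apply: eq_bigr => j _.
  by rewrite lambdaE mxE.
have [f [f0 fP]] := invariant_graph_exists phi0 upper nonres.
exists f; split=> //.
- by move=> g g0 gP; apply: (invariant_graph_unique phi0 upper nonres).
- exact: conjugated_conjugacy.
- exact: conjugated_linear_fixed.
Qed.
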